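(* Let $H$ be a complex Hilbert space. For any $f,g\in\Gamma_0(H)$ and $\lambda\in(0,1)$, $$f!_\lambda g\leq\mathbb{L}_\lambda(f,g)\leq f\nabla_\lambda g,$$ $$f!_\lambda g\leq\big(\mathbb{L}_\lambda(f^*,g^* )\big)^*\leq\mathfrak{L}_\lambda(f,g)\leq f\nabla_\lambda g.$$
   Context: $\Gamma_0(H)$ is the cone of convex lower semicontinuous functionals $f:H\to\mathbb{R}\cup\{+\infty\}$ that are not identically $+\infty$. Inequalities, algebraic operations and integrals of functionals are pointwise in $x\in H$ (values in $[-\infty,+\infty]$ are allowed for the derived functionals). The Fenchel conjugate of a functional $f$ is $$f^*(x^* ):=\sup_{x\in H}\big\{\mathrm{Re}\langle x^*,x\rangle-f(x)\big\},\qquad x^*\in H.$$ For $\lambda\in(0,1)$: $$f\nabla_\lambda g:=(1-\lambda)f+\lambda g,\qquad f!_\lambda g:=\big((1-\lambda)f^*+\lambda g^*\big)^*,\qquad f\sharp_\lambda g:=\int_0^1 f!_t g\,d\mu_\lambda(t),$$ $$d\mu_\lambda(t):=\frac{\sin(\pi\lambda)}{\pi}\,\frac{t^{\lambda-1}}{(1-t)^\lambda}\,dt,$$ with the endpoint conventions $f\nabla_0 g=f!_0 g=f\sharp_0 g=f$ and $f\nabla_1 g=f!_1 g=f\sharp_1 g=g$. For $\lambda\in(0,1)$, $\nu_\lambda$ is the probability measure on $[0,1]$ given by $$d\nu_\lambda(t)=\Big((1-\lambda)(1-t)^{\frac{1-2\lambda}{\lambda}}+\lambda t^{\frac{2\lambda-1}{1-\lambda}}\Big)dt,$$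 and the $\lambda$-weighted logarithmic functional means are $$\mathfrak{L}_\lambda(f,g):=\int_0^1 f\sharp_t g\,d\nu_\lambda(t),\qquad\mathbb{L}_\lambda(f,g):=\left(\int_0^1(f\nabla_t g)^*\,d\nu_\lambda(t)\right)^*.$$ *)

(* Defs.v *)
From HB Require Import structures.
From mathcomp Require Import all_boot all_order all_algebra.
From mathcomp Require Import complex.
From mathcomp Require Import all_classical all_reals all_analysis.

Set Implicit Arguments.
Unset Strict Implicit.
Unset Printing Implicit Defensive.

Import Order.TTheory GRing.Theory Num.Theory.
Import numFieldNormedType.Exports.

Local Open Scope classical_set_scope.
Local Open Scope ring_scope.
Local Open Scope ereal_scope.

(* [H] with the positive definite hermitian form [dot] is a complex Hilbert
   space when, moreover, [dot] induces the (complete) norm of [H]. *)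
Definition induces_norm (R : realType) (H : completeNormedModType R[i])
    (dot : {dot H for (@Num.conj R[i])}) : Prop :=
  forall x : H, (`|x| ^+ 2 = dot x x)%R.

Section functionals.
Context {R : realType} {H : completeNormedModType R[i]}.
Implicit Types f g : H -> \bar R.

Definition convex_functional f : Prop :=
  forall (x y : H) (t : R), (0 < t < 1)%R ->
    f ((real_complex R (1 - t)) *: x + (real_complex R t) *: y)%R <=
      (1 - t)%:E * f x + t%:E * f y.

Definition Gamma0 f : Prop :=
  [/\ forall x, f x != -oo,
      exists x, f x != +oo,
      convex_functional f &
      lower_semicontinuous f].

Definition arithmetic_fmean (t : R) f g : H -> \bar R :=
  if t == 0%R then f else if t == 1%R then g else
  fun x => (1 - t)%:E * f x + t%:E * g x.

End functionals.

Section densities.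
Context {R : realType}.

Definition mu_density (l t : R) : R :=
  (sin (pi * l) / pi * (t `^ (l - 1) / (1 - t) `^ l))%R.

Definition nu_density (l t : R) : R :=
  ((1 - l) * (1 - t) `^ ((1 - 2 * l) / l) +
   l * t `^ ((2 * l - 1) / (1 - l)))%R.

(* The integral over [0, 1] of F against the measure w(t)dt.  For the two
   densities above and 0 < l < 1, w is positive on ]0, 1[; its values at the
   end points, where powR takes conventional values, are irrelevant. *)
Definition integral01 (w : R -> R) (F : R -> \bar R) : \bar R :=
  \int[lebesgue_measure]_(t in `[0%R, 1%R]) ((w t)%:E * F t).

End densities.

Section means.
Context {R : realType} {H : completeNormedModType R[i]}.
Variable dot : {dot H for (@Num.conj R[i])}.
Implicit Types f g : H -> \bar R.

Definition fenchel f : H -> \bar R :=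
  fun y => ereal_sup [set (complex.Re (dot y x))%:E - f x | x in [set: H]].

Definition harmonic_fmean (t : R) f g : H -> \bar R :=
  if t == 0%R then f else if t == 1%R then g else
  fenchel (fun y => (1 - t)%:E * fenchel f y + t%:E * fenchel g y).

Definition geometric_fmean (t : R) f g : H -> \bar R :=
  if t == 0%R then f else if t == 1%R then g else
  fun x => integral01 (mu_density t) (fun s => harmonic_fmean s f g x).

Definition log_fmean (l : R) f g : H -> \bar R :=
  fun x => integral01 (nu_density l) (fun t => geometric_fmean t f g x).

Definition dual_log_fmean (l : R) f g : H -> \bar R :=
  fenchel (fun y =>
    integral01 (nu_density l) (fun t => fenchel (arithmetic_fmean t f g) y)).

End means.

(* Main.v *)
Require Import Defs.
From mathcomp Require Import all_boot all_order all_algebra.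
From mathcomp Require Import complex.
From mathcomp Require Import all_classical all_reals all_analysis.
From mathcomp Require Import measurable_realfun.
From mathcomp Require Import ring lra.
Import Order.TTheory GRing.Theory Num.Theory.
Import numFieldNormedType.Exports.
Set Implicit Arguments.
Unset Strict Implicit.
Unset Printing Implicit Defensive.
Local Open Scope classical_set_scope.
Local Open Scope ring_scope.

(** Write f° for the Fenchel conjugate of f. The weights [mu_density l] and
    [nu_density l] are probability densities with mean [l] ([barycenter_mu],
    [barycenter_nu]), so that integrating t |-> (1 - t) a + t b against either
    of them gives (1 - l) a + l b. Every inequality then comes from a pointwise
    comparison in t with such an affine function.

    - Upper bounds. A functional of t lying below t |-> (1 - t) f(x) + t g(x)
      integrates to at most (1 - l) f(x) + l g(x)
      ([integral01_le_arithmetic]).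
    - Lower bounds. The conjugate of the weighted arithmetic mean at y is a
      supremum over x of affine functions of t, and each of them can be
      integrated before the supremum is taken; this is Jensen's inequality
      ([fenchel_arithmetic_le_integral01]).

    What is left is the Fenchel-Young inequality: conjugation reverses the
    order, f°° <= f, and the conjugate of the arithmetic mean of f and g is at
    most the arithmetic mean of f° and g°. The harmonic mean is the conjugate
    of the arithmetic mean of f° and g°, which brings both chains into this
    form; the two inequalities around the conjugate of the dual logarithmic
    mean of f° and g° follow by conjugating the upper bound of the first chain
    and from f°° <= f. Integrals of arbitrary integrands can be compared,
    because the Lebesgue integral, being defined by suprema over simple
    functions, is monotone on all functions ([le_integral_pointwise]).

    The analytic content is thus the mass and the mean of the two densities,
    which are combinations of the kernels t^(a-1) (1-t)^(b-1). The recursions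
    of the Beta integral ([BetaDl], [BetaDr]) give everything except the total
    mass of [mu_density l], which is Euler's reflection formula
    B(l, 1 - l) = pi / sin (pi l) ([Beta_reflection]). For that, compare two
    sequences with explicit recursions. On one side,
    B(l + n, 1 - l + n) / B(n + 1, n + 1) tends to 2, since the weighted
    arithmetic-geometric mean inequality squeezes the kernel between
    combinations of integer shifts of B. On the other side, the integrals of
    cos(2 l x) cos(x)^(2n) over [0, pi/2], divided by the same integrals at
    frequency 0, tend to 1 because the mass of cos(x)^(2n) concentrates at 0;
    the case n = 0 is where sin (pi l) enters. The recursions make the product
    of the two ratios and of (n + l) / (2n + 1) independent of n, so its value
    sin (pi l) / pi * B(l, 1 - l) at n = 0 equals its limit 1. *)

(** * The fundamental theorem of calculus on an open interval *)

Section FTC_open.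
Context {R : realType}.
Local Notation mu := (@lebesgue_measure R).
Variables (F f : R -> R) (a b : R).
Hypothesis ab : a < b.
Hypothesis cf : {in `]a, b[, continuous f}.
Hypothesis dF : forall x, a < x < b -> is_derive x 1 F (f x).
Hypotheses (Fa : F x @[x --> a^'+] --> F a) (Fb : F x @[x --> b^'-] --> F b).

(* [[u n, v n]] increases to the open interval; the offset 3 keeps e n below
   half its length, so that u n < v n already for n = 0. *)
Let e n : R := (b - a) / n.+3%:R.
Let u n : R := a + e n.
Let v n : R := b - e n.

Let d_gt0 : 0 < b - a. Proof. by rewrite subr_gt0. Qed.

Let e_gt0 n : 0 < e n.
Proof. by rewrite /e divr_gt0. Qed.

Let e_lt n : e n < (b - a) / 2.
Proof. by rewrite /e ltr_pM2l// ltf_pV2 ?posrE// ltr_nat. Qed.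

Let uv n : u n < v n.
Proof. by have := ab; have := e_lt n; rewrite /u /v; move: (e n) => c; lra. Qed.

Let e_cvg : e n @[n --> \oo] --> (0 : R).
Proof.
rewrite -[X in _ --> X](mulr0 (b - a)); apply: cvgM; first exact: cvg_cst.
have := @cvg_harmonic R; rewrite -(cvg_shiftn 2) => h.
by under eq_fun do rewrite -addn2.
Qed.

Let Fu : F (u n) @[n --> \oo] --> F a.
Proof.
move/cvg_at_rightP : Fa; apply; split=> [n|]; first by rewrite ltrDl.
rewrite -[X in _ --> X]addr0; apply: cvgD; [exact: cvg_cst|exact: e_cvg].
Qed.

Let Fv : F (v n) @[n --> \oo] --> F b.
Proof.
move/cvg_at_leftP : Fb; apply; split=> [n|].
  by rewrite /v; have := e_gt0 n; lra.
rewrite -[X in _ --> X]subr0; apply: cvgB; [exact: cvg_cst|exact: e_cvg].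
Qed.

Let D n := `[u n, v n]%classic.

Let D_sub n : D n `<=` `]a, b[.
Proof.
move=> x; rewrite /D/= !in_itv/= /u /v => /andP[ux xv]; have := ab.
by have := e_gt0 n; lra.
Qed.

Let D_bigcup : `]a, b[%classic = \bigcup_n D n.
Proof.
apply/seteqP; split=> [x|x [n _]]; last exact: D_sub.
rewrite /= in_itv/= => /andP[ax xb].
have e0 : 0 < Num.min (x - a) (b - x) by rewrite lt_min; lra.
have /cvgrPdist_lt /(_ _ e0)[N _ /(_ N (leqnn N))] := e_cvg.
rewrite /= sub0r normrN gtr0_norm// lt_min => /andP[h1 h2].
by exists N => //; rewrite /D /= in_itv /= /u /v; lra.
Qed.

Let D_mono : nondecreasing_seq D.
Proof.
move=> m n mn; apply/subsetPset => x; rewrite /D/= !in_itv/= /u /v.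
have : e n <= e m.
  by rewrite /e ler_pM2l// lef_pV2 ?posrE// ler_nat.
by lra.
Qed.

Let mf : measurable_fun `]a, b[ f.
Proof.
apply: open_continuous_measurable_fun; first exact: interval_open.
by move=> x; rewrite inE; exact: cf.
Qed.

Let integralD_ n : (\int[mu]_(x in D n) (f x)%:E = (F (v n) - F (u n))%:E)%E.
Proof.
rewrite EFinB; apply: continuous_FTC2 => //.
- apply: continuous_in_subspaceT => x /set_mem/D_sub xab.
  by apply: cf; rewrite inE.
- have dFD x : x \in `[u n, v n] -> derivable F x 1.
    move=> xD; have /= : `]a, b[%classic x by apply: (@D_sub n).
    by rewrite in_itv => /dF[].
  have /(continuous_within_itvP _ (uv n))[_ cu cv] :=
    derivable_within_continuous dFD.
  split => // x xD; apply: dFD; exact: subset_itv_oo_cc xD.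
- move=> x xD; rewrite derive1E; apply: derive_val.
  have /= : `]a, b[%classic x.
    apply: (@D_sub n); move: xD; rewrite /D /= !in_itv/=; lra.
  by rewrite in_itv => /dF.
Qed.

Let cvgFD :
  (\int[mu]_(x in D n) (f x)%:E)%E @[n --> \oo] --> (F b - F a)%:E.
Proof.
rewrite (_ : (fun n => _) = fun n => (F (v n) - F (u n))%:E); last first.
  by apply/funext => n; exact: integralD_.
by apply: cvg_EFin; [near=> n|apply: cvgB]. Unshelve. all: by end_near.
Qed.

Let mD n : measurable (D n).
Proof. exact: measurable_itv. Qed.

Let mfD n : measurable_fun (D n) (EFin \o f).
Proof. by apply/measurable_EFinP; apply: measurable_funS mf. Qed.

(** The derivative may blow up at both ends, where the primitive stays
    continuous. Since the value is finite, integrability comes out of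
    positivity; this is how the integrability of the Beta kernels starts. *)
Lemma ge0_FTC2_oo : (forall x, a < x < b -> 0 <= f x) ->
  (\int[mu]_(x in `]a, b[) (f x)%:E = (F b - F a)%:E)%E.
Proof.
move=> f0; rewrite D_bigcup; apply: cvg_unique cvgFD => //.
apply: ge0_nondecreasing_set_cvg_integral => // n x /D_sub.
by rewrite /= in_itv/= lee_fin => /f0.
Qed.

Lemma integrable_FTC2_oo : mu.-integrable `]a, b[ (EFin \o f) ->
  \int[mu]_(x in `]a, b[) f x = F b - F a.
Proof.
move=> intf; rewrite /Rintegral; suff -> :
  (\int[mu]_(x in `]a, b[) (f x)%:E = (F b - F a)%:E)%E by [].
apply: cvg_unique cvgFD => //.
rewrite (_ : (fun n => _) = fun n => (\int[mu]_(x in D n) (EFin \o f)^\+ x -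
    \int[mu]_(x in D n) (EFin \o f)^\- x)%E); last first.
  by apply/funext => n; rewrite [LHS]integralE.
rewrite integralE; apply: cvgeB.
- apply: fin_num_adde_defl; rewrite fin_numN.
  exact: integrable_neg_fin_num.
- rewrite D_bigcup; apply: ge0_nondecreasing_set_cvg_integral => // n.
  by apply: measurable_funepos; apply: mfD.
- rewrite D_bigcup; apply: ge0_nondecreasing_set_cvg_integral => // n.
  by apply: measurable_funeneg; apply: mfD.
Qed.

End FTC_open.

(** * The Beta integral with real parameters *)

Section Beta.
Context {R : realType}.
Local Notation mu := (@lebesgue_measure R).
Local Notation I01 := (`]0, 1[%classic : set R).
Implicit Types a b t : R.

Definition beta_ker a b t : R := t `^ (a - 1) * (1 - t) `^ (b - 1).

Definition Beta a b : R := \int[mu]_(t in I01) beta_ker a b t.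

Lemma cvg_at_left_1B (f : R -> R) (l : R) :
  f x @[x --> 0^'+] --> l -> f (1 - x) @[x --> 1^'-] --> l.
Proof.
move=> /cvg_at_rightP fl; apply/cvg_at_leftP => u [u1 ucv].
apply: (fl (fun n => 1 - u n)); split=> [n|]; first by rewrite subr_gt0.
by rewrite -(subrr 1); apply: cvgB => //; exact: cvg_cst.
Qed.

Lemma is_derive_cvg (F : R -> R) (d t : R) :
  is_derive t 1 F d -> F x @[x --> t] --> F t.
Proof.
by move=> [dF _]; apply: differentiable_continuous; exact/derivable1_diffP.
Qed.

Lemma powR_cvg a t : 0 < t -> x `^ a @[x --> t] --> t `^ a.
Proof.
by move=> t0; exact: is_derive_cvg (is_derive1_powR a t0).
Qed.

Lemma is_derive_1B t : is_derive t 1 (fun x : R => 1 - x) (-1).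
Proof.
have := is_deriveB (is_derive_cst (1 : R) t 1) (is_derive_id t 1).
by move/is_derive_eq; apply; rewrite sub0r.
Qed.

Lemma is_derive_powR_1B b t : t < 1 ->
  is_derive t 1 (fun x => (1 - x) `^ b) (- (b * (1 - t) `^ (b - 1))).
Proof.
move=> t1; have t1' : 0 < 1 - t by rewrite subr_gt0.
have := @is_derive1_comp _ (fun x => x `^ b) (fun x => 1 - x) _ _ _
  (is_derive1_powR b t1') (is_derive_1B t).
by rewrite mulrN1.
Qed.

(** The derivative of t^a (1-t)^b; its vanishing at both ends is what makes
    the integration by parts in [Beta_parts] free of boundary terms. *)
Lemma is_derive_beta_ker a b t : 0 < t < 1 ->
  is_derive t 1 (beta_ker (a + 1) (b + 1))
    (a * beta_ker a (b + 1) t - b * beta_ker (a + 1) b t).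
Proof.
move=> /andP[t0 t1]; rewrite /beta_ker !addrK.
have := is_deriveM (is_derive1_powR a t0) (is_derive_powR_1B b t1).
by move/is_derive_eq; apply; rewrite /GRing.scale/=; ring.
Qed.

Lemma continuous_beta_ker a b : {in `]0, 1[, continuous (beta_ker a b)}.
Proof.
move=> t; rewrite in_itv/= => t01; have := is_derive_beta_ker (a - 1) (b - 1) t01.
by rewrite !subrK; exact: is_derive_cvg.
Qed.

Lemma beta_ker_gt0 a b t : 0 < t < 1 -> 0 < beta_ker a b t.
Proof. by move=> /andP[t0 t1]; rewrite mulr_gt0// powR_gt0// subr_gt0. Qed.

Lemma powR_mul a t : 0 < t -> t `^ a = t * t `^ (a - 1).
Proof.
by move=> t0; rewrite powRB ?(gt_eqF t0) ?implybT// powRr1 ?ltW// mulrCA divff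
  ?mulr1// gt_eqF.
Qed.

Lemma beta_kerDl a b t : 0 < t < 1 -> beta_ker (a + 1) b t = t * beta_ker a b t.
Proof. by move=> /andP[t0 t1]; rewrite /beta_ker addrK powR_mul// mulrA. Qed.

Lemma beta_kerDr a b t : 0 < t < 1 -> beta_ker a (b + 1) t = (1 - t) * beta_ker a b t.
Proof.
by move=> /andP[t0 t1]; rewrite /beta_ker addrK (powR_mul b) ?subr_gt0// mulrCA.
Qed.

Lemma measurable_beta_ker a b : measurable_fun I01 (beta_ker a b).
Proof.
apply: open_continuous_measurable_fun; first exact: interval_open.
by move=> t; rewrite inE; exact: continuous_beta_ker.
Qed.

Lemma integral_beta_ker1r a : 0 < a ->
  (\int[mu]_(t in I01) (beta_ker a 1 t)%:E = (a^-1)%:E)%E.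
Proof.
move=> a0; pose F (t : R) := t `^ a / a.
have FE : F 1 - F 0 = a^-1.
  by rewrite /F powR1 powR0 ?gt_eqF// mul0r subr0 mul1r.
rewrite -FE; apply: (@ge0_FTC2_oo _ F (beta_ker a 1)) => //.
- exact: continuous_beta_ker.
- move=> t /andP[t0 t1].
  have := is_deriveM (is_derive1_powR a t0) (is_derive_cst (a^-1) t 1).
  move/is_derive_eq; apply; rewrite /beta_ker subrr powRr0 mulr1 scaler0 add0r.
  by rewrite /GRing.scale/= mulKf// gt_eqF.
- apply: cvgM; last exact: cvg_cst.
  by rewrite powR0 ?gt_eqF//; exact: powR_cvg0.
- apply: cvgM; last exact: cvg_cst.
  by apply: cvg_at_left_filter; exact: powR_cvg.
- by move=> t /(beta_ker_gt0 a 1)/ltW.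
Qed.

Lemma integral_beta_ker1l b : 0 < b ->
  (\int[mu]_(t in I01) (beta_ker 1 b t)%:E = (b^-1)%:E)%E.
Proof.
move=> b0; pose F (t : R) := - ((1 - t) `^ b / b).
have FE : F 1 - F 0 = b^-1.
  by rewrite /F subrr subr0 powR1 powR0 ?gt_eqF// mul0r oppr0 sub0r opprK mul1r.
rewrite -FE; apply: (@ge0_FTC2_oo _ F (beta_ker 1 b)) => //.
- exact: continuous_beta_ker.
- move=> t /andP[t0 t1].
  have := is_deriveN
    (is_deriveM (is_derive_powR_1B b t1) (is_derive_cst (b^-1) t 1)).
  move/is_derive_eq; apply; rewrite /beta_ker subrr powRr0 mul1r scaler0 add0r.
  by rewrite /GRing.scale/= mulrN opprK mulKf// gt_eqF.
- apply: cvgN; apply: cvgM; last exact: cvg_cst.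
  apply: cvg_at_right_filter.
  exact: is_derive_cvg (is_derive_powR_1B b (@ltr01 R)).
- apply: cvgN; apply: cvgM; last exact: cvg_cst.
  rewrite subrr powR0 ?gt_eqF//.
  exact: (@cvg_at_left_1B (fun x => x `^ b) 0 (powR_cvg0 b0)).
- by move=> t /(beta_ker_gt0 1 b)/ltW.
Qed.

(** At most one of the two factors is singular on each half of the interval,
    and the other one is bounded by 2 there because x^(c-1) <= 1/x. *)
Lemma beta_ker_le a b t : 0 < a -> 0 < b -> 0 < t < 1 ->
  beta_ker a b t <= 2 * (beta_ker a 1 t + beta_ker 1 b t).
Proof.
move=> a0 b0 /andP[t0 t1].
have bnd x c : 0 < c -> 2^-1 <= x <= 1 -> x `^ (c - 1) <= 2.
  move=> c0 /andP[x2 x1]; have x0 : 0 < x by rewrite (lt_le_trans _ x2).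
  rewrite -[leRHS]invrK; apply: (@le_trans _ _ x^-1).
    have x01 : 0 < x <= 1 by rewrite x0.
    rewrite -(powR_inv1 (ltW x0)). apply: (ger_powR x01).
    by rewrite lerBrDr addNr ltW.
  by rewrite lef_pV2// ?posrE ?invr_gt0.
rewrite /beta_ker !subrr !powRr0 mulr1 mul1r.
have p0 := powR_ge0 t (a - 1); have q0 := powR_ge0 (1 - t) (b - 1).
have [th|th] := leP t 2^-1.
- have : (1 - t) `^ (b - 1) <= 2 by apply: bnd => //; lra.
  by nra.
- have : t `^ (a - 1) <= 2 by apply: bnd => //; lra.
  by nra.
Qed.

Lemma integrable_beta_ker a b : 0 < a -> 0 < b ->
  mu.-integrable I01 (EFin \o beta_ker a b).
Proof.
have base c d (v : R) : (\int[mu]_(t in I01) (beta_ker c d t)%:E = v%:E)%E ->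
    mu.-integrable I01 (EFin \o beta_ker c d).
  move=> cdE; apply/integrableP; split.
    by apply/measurable_EFinP; exact: measurable_beta_ker.
  rewrite (_ : (\int[mu]_(x in _) _)%E = v%:E) ?ltry// -cdE.
  apply: eq_integral => t; rewrite inE/= in_itv/= => /(beta_ker_gt0 c d)/ltW t0.
  by rewrite ger0_norm.
move=> a0 b0.
apply: (@le_integrable _ _ _ mu I01 _ _
    (fun t => 2%:E * ((EFin \o beta_ker a 1) t + (EFin \o beta_ker 1 b) t))%E) => //.
- by apply/measurable_EFinP; exact: measurable_beta_ker.
- move=> t; rewrite /= in_itv/= => t01.
  rewrite lee_fin !ger0_norm ?beta_ker_le//.
    by rewrite mulr_ge0// addr_ge0// ltW// beta_ker_gt0.
  by rewrite ltW// beta_ker_gt0.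
- apply: integrableZl => //; apply: integrableD => //.
  + exact: base (integral_beta_ker1r a0).
  + exact: base (integral_beta_ker1l b0).
Qed.

Lemma Beta1r a : 0 < a -> Beta a 1 = a^-1.
Proof. by move=> a0; rewrite /Beta /Rintegral integral_beta_ker1r. Qed.

Lemma Beta1l b : 0 < b -> Beta 1 b = b^-1.
Proof. by move=> b0; rewrite /Beta /Rintegral integral_beta_ker1l. Qed.

(** From t + (1 - t) = 1. Together with [Beta_parts] this is a linear system
    for the two shifts of B(a, b), solved in [BetaDl] and [BetaDr]. *)
Lemma Beta_split a b : 0 < a -> 0 < b ->
  Beta a b = Beta (a + 1) b + Beta a (b + 1).
Proof.
move=> a0 b0; rewrite /Beta -RintegralD//; last 2 first.
- by apply: integrable_beta_ker; lra.
- by apply: integrable_beta_ker; lra.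
apply: eq_Rintegral => t; rewrite inE/= in_itv/= => t01.
by rewrite beta_kerDl// beta_kerDr//; ring.
Qed.

Lemma Beta_parts a b : 0 < a -> 0 < b ->
  a * Beta a (b + 1) = b * Beta (a + 1) b.
Proof.
move=> a0 b0; apply/eqP; rewrite -subr_eq0; apply/eqP.
have ia : mu.-integrable I01 (EFin \o beta_ker a (b + 1)).
  by apply: integrable_beta_ker; lra.
have ib : mu.-integrable I01 (EFin \o beta_ker (a + 1) b).
  by apply: integrable_beta_ker; lra.
have iZ c (f : R -> R) : mu.-integrable I01 (EFin \o f) ->
    mu.-integrable I01 (EFin \o (fun t => c * f t)).
  by move=> fi; exact: (integrableZl _ c fi).
rewrite /Beta -!RintegralZl// -RintegralB//; [|exact: iZ..].
have F0 : beta_ker (a + 1) (b + 1) 0 = 0.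
  by rewrite /beta_ker addrK powR0 ?mul0r// gt_eqF.
have F1 : beta_ker (a + 1) (b + 1) 1 = 0.
  by rewrite /beta_ker !addrK subrr powR0 ?mulr0// gt_eqF.
have := @integrable_FTC2_oo _ (beta_ker (a + 1) (b + 1))
  (fun t => a * beta_ker a (b + 1) t - b * beta_ker (a + 1) b t) 0 1 ltr01.
rewrite F0 F1 subrr; apply.
- move=> t t01; apply: cvgB; apply: cvgM; try exact: cvg_cst.
  + exact: continuous_beta_ker.
  + exact: continuous_beta_ker.
- by move=> t; exact: is_derive_beta_ker.
- rewrite /beta_ker !addrK -[X in _ --> X](mul0r (1 `^ b)); apply: cvgM.
    exact: powR_cvg0.
  rewrite -[X in X `^ b](subr0 1) -[X in _ --> X]/((fun x => (1 - x) `^ b) 0).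
  apply: cvg_at_right_filter.
  exact: is_derive_cvg (is_derive_powR_1B b (@ltr01 R)).
- rewrite /beta_ker !addrK -[X in _ --> X](mulr0 (1 `^ a)); apply: cvgM.
    by apply: cvg_at_left_filter; exact: powR_cvg.
  exact: (@cvg_at_left_1B (fun x => x `^ b) 0 (powR_cvg0 b0)).
- exact: (integrableB _ (iZ a _ ia) (iZ b _ ib)).
Qed.

Lemma BetaDl a b : 0 < a -> 0 < b -> Beta (a + 1) b = a / (a + b) * Beta a b.
Proof.
move=> a0 b0; have := Beta_split a0 b0; have := Beta_parts a0 b0.
have ab0 : a + b != 0 by rewrite gt_eqF// addr_gt0.
move=> E1 E2; apply: (mulfI ab0); rewrite mulrA mulrCA divff// mulr1.
by rewrite E2 mulrDr E1; ring.
Qed.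

Lemma BetaDr a b : 0 < a -> 0 < b -> Beta a (b + 1) = b / (a + b) * Beta a b.
Proof.
move=> a0 b0; have := Beta_split a0 b0; rewrite BetaDl// => E.
have ab0 : a + b != 0 by rewrite gt_eqF// addr_gt0.
have -> : Beta a (b + 1) = Beta a b - a / (a + b) * Beta a b.
  by rewrite [X in X - _]E; ring.
by field.
Qed.

End Beta.

(** * Wallis integrals with a frequency *)

Section CosineIntegrals.
Context {R : realType}.
Local Notation mu := (@lebesgue_measure R).
Implicit Types c x : R.

(** Even powers of the cosine only; for [c = 0] these are Wallis' integrals.
    The exponent is [n + n] so that it unfolds by two at each step. *)
Definition wallis c n : R :=
  \int[mu]_(x in `[0, pi / 2]) (cos (c * x) * cos x ^+ (n + n)).

Lemma MVT_sin x : 0 < x -> exists2 y, 0 < y < x & sin x = cos y * x.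
Proof.
move=> x0.
have [y yx E] := @MVT R sin cos 0 x x0 (fun y _ => is_derive_sin y)
  (continuous_subspaceT (@continuous_sin R)).
by exists y; [move: yx; rewrite in_itv|move: E; rewrite sin0 !subr0].
Qed.

Lemma normr_sin_le x : `|sin x| <= `|x|.
Proof.
wlog x0 : x / 0 <= x.
  move=> h; have [|/ltW x0] := leP 0 x; first exact: h.
  by rewrite -normrN -sinN -[leRHS]normrN h// oppr_ge0.
move: x0; rewrite le_eqVlt => /predU1P[<-|x0]; first by rewrite sin0.
have [y _ ->] := MVT_sin x0.
by rewrite normrM ler_piMl// cos_max.
Qed.

(** The mean value theorem gives sin x = x cos y with y < x, and the cosine
    decreases. *)
Lemma mulr_cos_le_sin x : 0 <= x <= pi / 2 -> x * cos x <= sin x.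
Proof.
move=> /andP[]; rewrite le_eqVlt => /predU1P[<- _|x0 xpi].
  by rewrite mul0r sin0.
have [y /andP[y0 yx] ->] := MVT_sin x0; rewrite mulrC ler_pM2r//.
have pi0 := pi_gt0 R.
have xin : x \in `[0, pi] by rewrite in_itv/=; apply/andP; split; lra.
have yin : y \in `[0, pi] by rewrite in_itv/=; apply/andP; split; lra.
by apply: ltW; rewrite ltr_cos.
Qed.

(** From 1 - cos(cx) = 2 sin(cx/2)^2 <= (cx)^2/2 and x cos x <= sin x. The
    factor cos(x)^2 turns the bound x^2 into sin(x)^2 = 1 - cos(x)^2, whose
    integral against a power of the cosine is a difference of Wallis
    integrals. *)
Lemma cos_near1 c x : 0 <= x <= pi / 2 ->
  0 <= (1 - cos (c * x)) * cos x ^+ 2 <= c ^+ 2 / 2 * sin x ^+ 2.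
Proof.
move=> /[dup] xpi /mulr_cos_le_sin xs; apply/andP; split.
  by rewrite mulr_ge0 ?sqr_ge0// subr_ge0 cos_le1.
have x0 : 0 <= x by case/andP : xpi.
have cx0 : 0 <= cos x.
  by apply: cos_ge0_pihalf; have := pi_gt0 R; case/andP : xpi; lra.
have -> : 1 - cos (c * x) = 2 * sin (c * x / 2) ^+ 2.
  rewrite -[X in cos X](_ : (c * x / 2) *+ 2 = _); last first.
    by rewrite -mulr_natr mulfVK.
  by rewrite cos_mulr2n sin2cos2 -mulr_natr; ring.
have h1 : sin (c * x / 2) ^+ 2 <= (c * x / 2) ^+ 2.
  by rewrite -(ler_sqrt _ (sqr_ge0 _)) !sqrtr_sqr normr_sin_le.
have h2 : (x * cos x) ^+ 2 <= sin x ^+ 2.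
  by rewrite ler_sqr ?nnegrE// ?(le_trans _ xs)// mulr_ge0.
apply: (@le_trans _ _ (2 * (c * x / 2) ^+ 2 * cos x ^+ 2)).
  by rewrite ler_wpM2r ?sqr_ge0// ler_pM2l.
have -> : 2 * (c * x / 2) ^+ 2 * cos x ^+ 2 = c ^+ 2 / 2 * (x * cos x) ^+ 2.
  by field.
by rewrite ler_wpM2l// divr_ge0// sqr_ge0.
Qed.

Let pihalf_gt0 : 0 < pi / 2 :> R.
Proof. by rewrite divr_gt0// pi_gt0. Qed.

Lemma is_derive_mulr c x : is_derive x 1 (fun y => c * y) c.
Proof.
have := is_deriveZ c (is_derive_id x 1).
by move/is_derive_eq; apply; rewrite /GRing.scale/= mulr1.
Qed.

Lemma is_derive_cosZ c x :
  is_derive x 1 (fun y => cos (c * y)) (- (c * sin (c * x))).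
Proof.
have := @is_derive1_comp _ cos (fun y => c * y) _ _ _
  (is_derive_cos _) (is_derive_mulr c x).
by move/is_derive_eq; apply; ring.
Qed.

Lemma is_derive_sinZ c x :
  is_derive x 1 (fun y => sin (c * y)) (c * cos (c * x)).
Proof.
have := @is_derive1_comp _ sin (fun y => c * y) _ _ _
  (is_derive_sin _) (is_derive_mulr c x).
by move/is_derive_eq; apply; ring.
Qed.

Lemma is_derive_continuous (F f : R -> R) :
  (forall x, is_derive x 1 F (f x)) -> continuous F.
Proof. by move=> dF x; exact: is_derive_cvg (dF x). Qed.

Lemma FTC2_pihalf (F f : R -> R) :
  (forall x, is_derive x 1 F (f x)) -> continuous f ->
  \int[mu]_(x in `[0, pi / 2]) f x = F (pi / 2) - F 0.
Proof.
move=> dF cf; have cF := is_derive_continuous dF.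
rewrite /Rintegral (continuous_FTC2 (F := F))//.
- exact: continuous_subspaceT.
- split=> [x _||]; first by have [] := dF x.
    by apply: cvg_at_right_filter; exact: cF.
  by apply: cvg_at_left_filter; exact: cF.
- by move=> x _; rewrite derive1E; apply: derive_val.
Qed.

Lemma continuous_wallis c n :
  continuous (fun x : R => cos (c * x) * cos x ^+ n).
Proof.
move=> x; apply: cvgM.
  exact: (is_derive_continuous (is_derive_cosZ c)).
by apply: (@cvg_comp _ _ _ cos (fun y => y ^+ n)) (@exprn_continuous _ n _);
  exact: continuous_cos.
Qed.

Lemma integrable_continuous (f : R -> R) : continuous f ->
  mu.-integrable `[0, pi / 2] (EFin \o f).
Proof.
move=> cf; apply: continuous_compact_integrable; first exact: segment_compact.
exact: continuous_subspaceT.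
Qed.

(** With m = 2n + 2, the function
    m cos(cx) cos(x)^(m-1) sin x - c sin(cx) cos(x)^m vanishes at 0 and pi/2,
    and its derivative is
    (m^2 - c^2) cos(cx) cos(x)^m - m (m-1) cos(cx) cos(x)^(m-2). *)
Lemma wallis_rec c n :
  ((n.+1 + n.+1)%:R ^+ 2 - c ^+ 2) * wallis c n.+1 =
  (n.+1 + n.+1)%:R * (n.+1 + n)%:R * wallis c n.
Proof.
pose m : R := (n.+1 + n.+1)%:R.
have mE : (n.+1 + n)%:R = m - 1 by rewrite /m addnS -natr1 addrK.
rewrite mE -/m.
pose G x := m * (cos (c * x) * (cos x ^+ (n.+1 + n) * sin x)) -
            c * (sin (c * x) * cos x ^+ (n.+1 + n.+1)).
pose g x := (m ^+ 2 - c ^+ 2) * (cos (c * x) * cos x ^+ (n.+1 + n.+1)) -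
            m * (m - 1) * (cos (c * x) * cos x ^+ (n + n)).
have dX k x : is_derive x 1 (fun y : R => cos y ^+ k.+1)
    (- (k.+1%:R * (cos x ^+ k * sin x))).
  have := is_deriveX k.+1 (is_derive_cos x); rewrite exprfctE.
  by move/is_derive_eq; apply; rewrite /GRing.scale/=; ring.
have dG x : is_derive x 1 G (g x).
  have := is_deriveB
    (is_deriveZ m (is_deriveM (is_derive_cosZ c x)
      (is_deriveM (dX (n + n)%N x) (is_derive_sin x))))
    (is_deriveZ c (is_deriveM (is_derive_sinZ c x) (dX (n.+1 + n)%N x))).
  rewrite -[(n + n).+1]/(n.+1 + n)%N -[(n.+1 + n).+1]addnS.
  move/is_derive_eq; apply; rewrite /g /GRing.scale/= -/m mE mulrfctE.
  rewrite addnS addSn !exprS.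
  have s2 : sin x * sin x = 1 - cos x * cos x by rewrite -!expr2 sin2cos2.
  ring: s2.
have cg : continuous g.
  by move=> x; apply: cvgB; apply: cvgM; try exact: cvg_cst;
    exact: continuous_wallis.
have := FTC2_pihalf dG cg.
have -> : G (pi / 2) - G 0 = 0.
  rewrite /G cos_pihalf sin0 !mulr0 !expr0n/= !(mulr0, mul0r) sin0 mul0r.
  by rewrite mulr0 !subr0.
have iZ k a : mu.-integrable `[0, pi / 2]
   (EFin \o (fun x : R => a * (cos (c * x) * cos x ^+ k))).
  apply: integrable_continuous => x; apply: cvgM; first exact: cvg_cst.
  exact: continuous_wallis.
rewrite /g RintegralB// !RintegralZl//; [|
  by apply: integrable_continuous; exact: continuous_wallis..].
by move/eqP; rewrite subr_eq0 => /eqP.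
Qed.

Lemma wallis0 c : c != 0 -> wallis c 0 = sin (c * (pi / 2)) / c.
Proof.
move=> c0; pose G x := c^-1 * sin (c * x).
have dG x : is_derive x 1 G (cos (c * x) * cos x ^+ 0).
  have := is_deriveZ (c^-1) (is_derive_sinZ c x).
  by move/is_derive_eq; apply; rewrite /GRing.scale/= expr0 mulr1 mulKf.
rewrite /wallis (FTC2_pihalf dG); last exact: (@continuous_wallis c 0).
by rewrite /G mulr0 sin0 mulr0 subr0 mulrC.
Qed.

Lemma wallis00 : wallis 0 0 = pi / 2.
Proof.
have d0 (x : R) : is_derive x 1 id (cos (0 * x) * cos x ^+ 0).
  by rewrite mul0r cos0 expr0 mul1r; exact: is_derive_id.
by rewrite /wallis (FTC2_pihalf d0) ?subr0//; exact: (@continuous_wallis 0 0).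
Qed.

Lemma wallis0_gt0 n : 0 < wallis 0 n.
Proof.
elim: n => [|n IHn]; first by rewrite wallis00.
have m0 : 0 < (n.+1 + n.+1)%:R :> R by rewrite ltr0n.
have := wallis_rec 0 n; rewrite expr0n/= subr0 => E.
by rewrite -(pmulr_rgt0 _ (exprn_gt0 2 m0)) E !mulr_gt0// ltr0n.
Qed.

(** The right-hand side is of order 1/n relative to [wallis 0 n.+1], which gives
    the convergence of [wallis c n / wallis 0 n] to 1. *)
Lemma wallis_diff c n :
  0 <= wallis 0 n.+1 - wallis c n.+1 <= c ^+ 2 / 2 * (wallis 0 n - wallis 0 n.+1).
Proof.
have ic d k : mu.-integrable `[0, pi / 2]
   (EFin \o (fun x : R => cos (d * x) * cos x ^+ k)).
  by apply: integrable_continuous; exact: continuous_wallis.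
have iB d d' k k' : mu.-integrable `[0, pi / 2]
   (EFin \o (fun x : R => cos (d * x) * cos x ^+ k - cos (d' * x) * cos x ^+ k')).
  by have := integrableB _ (ic d k) (ic d' k'); apply.
have cosE k x : cos x ^+ (k.+1 + k.+1) = cos x ^+ 2 * cos x ^+ (k + k).
  by rewrite addnS addSn -add2n exprD.
have nn k x : 0 <= cos x ^+ (k + k).
  by rewrite addnn -mul2n exprM exprn_ge0// sqr_ge0.
rewrite /wallis -!RintegralB//; apply/andP; split.
  apply: Rintegral_ge0 => x; rewrite /= in_itv/= => /(cos_near1 c)/andP[h _].
  by rewrite cosE mul0r cos0 -mulrBl mulrA mulr_ge0.
rewrite -RintegralZl//; apply: le_Rintegral => //.
  by have := integrableZl _ (c ^+ 2 / 2) (iB 0 0 (n + n)%N (n.+1 + n.+1)%N); apply.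
move=> x; rewrite /= in_itv/= => /(cos_near1 c)/andP[_ h].
rewrite !cosE !mul0r cos0; have := ler_wpM2r (nn n x) h.
rewrite sin2cos2; congr (_ <= _); ring.
Qed.

End CosineIntegrals.

(** * Euler's reflection formula *)

Section Reflection.
Context {R : realType}.
Local Notation mu := (@lebesgue_measure R).
Local Notation I01 := (`]0, 1[%classic : set R).
Implicit Types l t x y : R.

(** Young's inequality for the conjugate exponents 1/l and 1/(1-l). *)
Lemma powR_le_mean l x y : 0 < l < 1 -> 0 < x -> 0 < y ->
  x `^ l * y `^ (1 - l) <= l * x + (1 - l) * y.
Proof.
move=> /andP[l0 l1] x0 y0; have l1' : 0 < 1 - l by rewrite subr_gt0.
have := @conjugate_powR R (x `^ l) (y `^ (1 - l)) l^-1 (1 - l)^-1.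
rewrite !powR_ge0 !invr_gt0 !invrK subrKC -!powRrM !divff ?gt_eqF//.
by rewrite (powRr1 (ltW x0)) (powRr1 (ltW y0)) (mulrC l) (mulrC (1 - l) y); apply.
Qed.

Variable l : R.
Hypothesis l01 : 0 < l < 1.

Let l_gt0 : 0 < l. Proof. by case/andP : l01. Qed.
Let l_lt1 : l < 1. Proof. by case/andP : l01. Qed.

(** The kernel of B(l+r, 1-l+r) is the kernel of B(r+1, r+1) divided by a
    weighted geometric mean of 1-t and t. The next two lemmas bound the
    inverse of that geometric mean from above by the arithmetic mean of the
    inverses, and from below by 4 - 4A, where A is the arithmetic mean and
    4 - 4A is the tangent of 1/A at A = 1/2. *)
Lemma beta_ker_midE (r t : R) : 0 < t < 1 ->
  beta_ker (l + r) (1 - l + r) t =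
  beta_ker (r + 1) (r + 1) t * ((1 - t) `^ l * t `^ (1 - l))^-1.
Proof.
move=> /andP[t0 t1]; have t1' : 0 < 1 - t by rewrite subr_gt0.
rewrite /beta_ker !addrK invfM -!powRN.
have -> : l + r - 1 = r + - (1 - l) by ring.
have -> : 1 - l + r - 1 = r + - l by ring.
by rewrite !powRD ?(gt_eqF t0) ?(gt_eqF t1') ?implybT//; ring.
Qed.

Lemma beta_ker_mid_le (r t : R) : 0 < t < 1 ->
  beta_ker (l + r) (1 - l + r) t <=
  l * beta_ker (r + 1) r t + (1 - l) * beta_ker r (r + 1) t.
Proof.
move=> /[dup] t01 /andP[t0 t1]; have t1' : 0 < 1 - t by rewrite subr_gt0.
rewrite beta_ker_midE//.
have K0 := beta_ker_gt0 (r + 1) (r + 1) t01.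
have -> : beta_ker (r + 1) r t = beta_ker (r + 1) (r + 1) t * (1 - t)^-1.
  by rewrite beta_kerDr// mulrAC divff ?mul1r// gt_eqF.
have -> : beta_ker r (r + 1) t = beta_ker (r + 1) (r + 1) t * t^-1.
  by rewrite beta_kerDl// mulrAC divff ?mul1r// gt_eqF.
rewrite !(mulrCA _ (beta_ker _ _ _)) -mulrDr ler_pM2l//.
have xV (x a : R) : 0 < x -> (x `^ a)^-1 = x^-1 `^ a.
  by move=> x0; rewrite -powRN -mulN1r powRrM (powR_inv1 (ltW x0)).
by rewrite invfM !xV// powR_le_mean ?invr_gt0.
Qed.

Lemma beta_ker_mid_ge (r t : R) : 0 < t < 1 ->
  4 * beta_ker (r + 1) (r + 1) t -
  4 * (l * beta_ker (r + 1) (r + 1 + 1) t + (1 - l) * beta_ker (r + 1 + 1) (r + 1) t)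
  <= beta_ker (l + r) (1 - l + r) t.
Proof.
move=> /[dup] t01 /andP[t0 t1]; have t1' : 0 < 1 - t by rewrite subr_gt0.
rewrite beta_ker_midE// [beta_ker (r + 1) (r + 1 + 1) t]beta_kerDr//.
rewrite [beta_ker (r + 1 + 1) (r + 1) t]beta_kerDl//.
have K0 := beta_ker_gt0 (r + 1) (r + 1) t01; set K := beta_ker _ _ _ in K0 *.
set A := (1 - t) `^ l * t `^ (1 - l).
have A0 : 0 < A by rewrite mulr_gt0// powR_gt0.
have AM : A <= l * (1 - t) + (1 - l) * t by exact: powR_le_mean.
set B := l * (1 - t) + (1 - l) * t in AM.
have -> : 4 * K - 4 * (l * ((1 - t) * K) + (1 - l) * (t * K)) = K * (4 - 4 * B).
  by rewrite /B; ring.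
rewrite ler_pM2l//; apply: (@le_trans _ _ (4 - 4 * A)); first by lra.
rewrite -(ler_pM2r A0) mulVf ?gt_eqF//.
by have := sqr_ge0 (2 * A - 1); rewrite sqrrB; nra.
Qed.

Let c n : R := Beta (l + n%:R) (1 - l + n%:R).
Let D n : R := Beta (n%:R + 1) (n%:R + 1).

Let cS n : c n.+1 =
  (l + n%:R) * (1 - l + n%:R) / ((2 * n%:R + 1) * (2 * n%:R + 2)) * c n.
Proof.
have n0 : 0 <= n%:R :> R by []; have := l_gt0; have := l_lt1 => l1 l0.
rewrite /c -natr1 !addrA BetaDl ?BetaDr; [|lra..].
by field; rewrite !gt_eqF//; lra.
Qed.

Let DS n : D n.+1 =
  (n%:R + 1) ^+ 2 / ((2 * n%:R + 2) * (2 * n%:R + 3)) * D n.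
Proof.
have n0 : 0 <= n%:R :> R by [].
rewrite /D -natr1 BetaDl ?(@BetaDr _ (n%:R + 1) (n%:R + 1)); [|lra..].
by field; rewrite !gt_eqF//; lra.
Qed.

Let D_gt0 n : 0 < D n.
Proof.
elim: n => [|n IHn]; first by rewrite /D add0r Beta1r// invr1.
by rewrite DS mulr_gt0// divr_gt0 ?exprn_gt0 ?mulr_gt0//;
  have : 0 <= n%:R :> R by []; lra.
Qed.

Let iZ (k a b : R) : 0 < a -> 0 < b ->
  mu.-integrable I01 (EFin \o (fun t => k * beta_ker a b t)).
Proof. by move=> a0 b0; exact: (integrableZl _ k (integrable_beta_ker a0 b0)). Qed.

(* The two terms on the right-hand side of [beta_ker_mid_le] integrate to the
   same multiple of D, up to the weights l and 1 - l, so that l drops out of the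
   two bounds on c / D, which meet at 2 in the limit. *)
Let c_le n : c n.+1 <= (2 * n.+1%:R + 1) / n.+1%:R * D n.+1.
Proof.
pose r : R := n.+1%:R; have r0 : 0 < r by rewrite ltr0n.
have := l_gt0; have := l_lt1 => l1 l0.
have -> : (2 * n.+1%:R + 1) / n.+1%:R * D n.+1 =
    \int[mu]_(t in I01) (l * beta_ker (r + 1) r t + (1 - l) * beta_ker r (r + 1) t).
  rewrite RintegralD//; [|by apply: iZ; lra..].
  rewrite !RintegralZl//; [|by apply: integrable_beta_ker; lra..].
  rewrite -/(Beta (r + 1) r) -/(Beta r (r + 1)) /D -/r.
  rewrite !(BetaDl, BetaDr); [|lra..].
  by field; rewrite !gt_eqF//; lra.
apply: le_Rintegral => //.
- by apply: integrable_beta_ker; rewrite -/r; lra.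
- have h1 := @iZ l (r + 1) r; have h2 := @iZ (1 - l) r (r + 1).
  by have := integrableD _ (h1 _ _) (h2 _ _); apply=> //; lra.
- by move=> t; rewrite /= in_itv/= => /beta_ker_mid_le; apply.
Qed.

Let c_ge n : 2 * D n <= c n.
Proof.
pose r : R := n%:R; have r0 : 0 <= r by [].
have := l_gt0; have := l_lt1 => l1 l0.
have h1 : mu.-integrable I01 (EFin \o (fun t => 4 * beta_ker (r + 1) (r + 1) t)).
  by apply: iZ; lra.
have h2 : mu.-integrable I01
    (EFin \o (fun t => l * beta_ker (r + 1) (r + 1 + 1) t)) by apply: iZ; lra.
have h3 : mu.-integrable I01
    (EFin \o (fun t => (1 - l) * beta_ker (r + 1 + 1) (r + 1) t)).
  by apply: iZ; lra.
have h4 : mu.-integrable I01 (EFin \o (fun t =>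
    l * beta_ker (r + 1) (r + 1 + 1) t + (1 - l) * beta_ker (r + 1 + 1) (r + 1) t)).
  exact: (integrableD _ h2 h3).
have h5 : mu.-integrable I01 (EFin \o (fun t => 4 *
   (l * beta_ker (r + 1) (r + 1 + 1) t + (1 - l) * beta_ker (r + 1 + 1) (r + 1) t))).
  exact: (integrableZl _ 4 h4).
have -> : 2 * D n = \int[mu]_(t in I01) (4 * beta_ker (r + 1) (r + 1) t -
  4 * (l * beta_ker (r + 1) (r + 1 + 1) t + (1 - l) * beta_ker (r + 1 + 1) (r + 1) t)).
  rewrite RintegralB// RintegralZl//; last by apply: integrable_beta_ker; lra.
  rewrite RintegralZl// RintegralD//.
  rewrite !RintegralZl//; [|by apply: integrable_beta_ker; lra..].
  rewrite -/(Beta _ _) -/(Beta (r + 1) (r + 1 + 1)).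
  rewrite -/(Beta (r + 1 + 1) (r + 1)) /D -/r.
  rewrite [Beta (r + 1 + 1) (r + 1)]BetaDl; [|lra..].
  rewrite [Beta (r + 1) (r + 1 + 1)]BetaDr; [|lra..].
  by field; rewrite gt_eqF//; lra.
apply: le_Rintegral => //.
- exact: (integrableB _ h1 h5).
- by apply: integrable_beta_ker; rewrite -/r; lra.
- by move=> t; rewrite /= in_itv/= => /beta_ker_mid_ge; apply.
Qed.

Let ratio n : R := wallis (2 * l) n / wallis 0 n.

Let wallis0S n : wallis 0 n.+1 = (2 * n%:R + 1) / (2 * n%:R + 2) * wallis 0 n :> R.
Proof.
have n0 : 0 <= n%:R :> R by [].
have := @wallis_rec R 0 n; rewrite expr0n/= subr0 !natrD -!(natr1 n) => E.
apply: (@mulfI _ ((n%:R + 1 + (n%:R + 1)) ^+ 2)).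
  by rewrite expf_neq0// gt_eqF//; lra.
by rewrite E; field; rewrite gt_eqF//; lra.
Qed.

Let ratioS n : ratio n.+1 =
  (n%:R + 1) ^+ 2 / ((n%:R + 1 - l) * (n%:R + 1 + l)) * ratio n.
Proof.
have n0 : 0 <= n%:R :> R by []; have := l_gt0; have := l_lt1 => l1 l0.
have E0 := @wallis0_gt0 R n; have := @wallis_rec R (2 * l) n.
rewrite !natrD -!(natr1 n) /ratio wallis0S => E.
have -> : wallis (2 * l) n.+1 = ((n%:R + 1) * (2 * n%:R + 1) / 2 /
    ((n%:R + 1 - l) * (n%:R + 1 + l))) * wallis (2 * l) n.
  apply: (@mulfI _ ((n%:R + 1 + (n%:R + 1)) ^+ 2 - (2 * l) ^+ 2)).
    have -> : (n%:R + 1 + (n%:R + 1)) ^+ 2 - (2 * l) ^+ 2 =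
      4 * ((n%:R + 1 - l) * (n%:R + 1 + l)) by ring.
    by rewrite !mulf_neq0// gt_eqF//; lra.
  by rewrite E; clear E; field; rewrite !gt_eqF//; lra.
by field; rewrite !gt_eqF//; lra.
Qed.

Let ratio_bound n : 1 - 2 / (2 * n%:R + 1) <= ratio n.+1 <= 1.
Proof.
have n0 : 0 <= n%:R :> R by []; have := l_gt0; have := l_lt1 => l1 l0.
have E0 := @wallis0_gt0 R n; have E1 := @wallis0_gt0 R n.+1.
have := @wallis_diff R (2 * l) n.
have -> : wallis 0 n = (2 * n%:R + 2) / (2 * n%:R + 1) * wallis 0 n.+1 :> R.
  by rewrite wallis0S; field; rewrite !gt_eqF//; lra.
move=> /andP[h1 h2]; rewrite /ratio ler_pdivrMr// ler_pdivlMr// mul1r.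
rewrite -[X in _ && X]subr_ge0 h1 andbT.
rewrite mulrBl mul1r lerBlDr -lerBlDl; apply: (le_trans h2).
set z := wallis 0 n.+1 in E1 *.
have -> : (2 * n%:R + 2) / (2 * n%:R + 1) * z - z = z / (2 * n%:R + 1).
  by field; rewrite !gt_eqF//; lra.
rewrite [leRHS]mulrAC -[leRHS]mulrA ler_wpM2r//.
  by rewrite divr_ge0 ?ltW//; lra.
by rewrite ler_pdivrMr//; nra.
Qed.

(* The product of the two ratios telescopes up to the last factor, which is
   chosen to absorb what is left. *)
Let W n : R := ratio n * (c n / D n) * ((n%:R + l) / (2 * n%:R + 1)).

Let W_const n : W n = W 0.
Proof.
elim: n => // n <-; have n0 : 0 <= n%:R :> R by [].
have := l_gt0; have := l_lt1 => l1 l0; have D0 := D_gt0 n.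
rewrite /W ratioS cS DS -natr1.
by field; rewrite !gt_eqF//; lra.
Qed.

Let W_near1 n : `|W 0 - 1| <= 5 / n.+1%:R.
Proof.
have n0 : 0 <= n%:R :> R by []; have := l_gt0; have := l_lt1 => l1 l0.
rewrite -(W_const n.+1) /W; have D0 := D_gt0 n.+1.
have /andP[r1 r2] := ratio_bound n.
have q1 : 2 <= c n.+1 / D n.+1 by rewrite ler_pdivlMr// c_ge.
have q2 : c n.+1 / D n.+1 <= (2 * n.+1%:R + 1) / n.+1%:R.
  by rewrite ler_pdivrMr// c_le.
move: (ratio n.+1) r1 r2 => r r1 r2; move: (c n.+1 / D n.+1) q1 q2 => q q1 q2.
rewrite -(natr1 n) in q2 *; move: (n%:R : R) n0 r1 q2 => x x0 r1 q2.
(* |r p - 1| <= |r - 1| p + |p - 1|, each term being O(1/n) *)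
pose e := (x + 1)^-1; have e0 : 0 < e by rewrite invr_gt0; lra.
have xe : (x + 1) * e = 1 by rewrite /e divff// gt_eqF//; lra.
have {}r1 : 1 - 2 * e <= r.
  apply: le_trans r1; rewrite lerD2l lerN2 ler_pM2l// lef_pV2 ?posrE; lra.
pose s := (x + 1 + l) / (2 * (x + 1) + 1).
have d0 : 0 < 2 * (x + 1) + 1 by lra.
have s1 : (x + 1) / (2 * (x + 1) + 1) <= s.
  by rewrite /s ler_pM2r ?invr_gt0//; lra.
have s2 : s <= (x + 2) / (2 * (x + 1) + 1).
  by rewrite /s ler_pM2r ?invr_gt0//; lra.
have p1 : 1 - e <= q * s.
  apply: (@le_trans _ _ (2 * ((x + 1) / (2 * (x + 1) + 1)))).
    rewrite -subr_ge0.
    have -> : 2 * ((x + 1) / (2 * (x + 1) + 1)) - (1 - e) =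
      (x + 2) / (2 * (x + 1) + 1) * e by rewrite /e; field; lra.
    by rewrite !mulr_ge0 ?invr_ge0//; lra.
  by apply: ler_pM => //; rewrite divr_ge0//; lra.
have p2 : q * s <= 1 + e.
  have -> : 1 + e = (2 * (x + 1) + 1) / (x + 1) * ((x + 2) / (2 * (x + 1) + 1)).
    by rewrite /e; field; lra.
  apply: ler_pM => //; first by lra.
  by apply: le_trans s1; rewrite divr_ge0//; lra.
rewrite -/s -mulrA -/e; move: (q * s) p1 p2 => p p1 p2.
have e1 : e <= 1 by rewrite /e invf_le1; lra.
have -> : r * p - 1 = (r - 1) * p + (p - 1) by ring.
rewrite ler_norml; apply/andP; split; nra.
Qed.

Lemma Beta_reflection : Beta l (1 - l) = pi / sin (pi * l).
Proof.
have := l_gt0; have := l_lt1 => l1 l0.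
have W1 : W 0 = 1.
  apply/eqP; rewrite -subr_eq0 -normr_eq0 eq_le normr_ge0 andbT leNgt.
  apply/negP => W0; pose N := Num.bound (5 / `|W 0 - 1|).
  have := archi_boundP (ltW (divr_gt0 (ltr0n _ 5) W0)); rewrite -/N.
  rewrite ltr_pdivrMr// => h; have := W_near1 N.
  rewrite ler_pdivlMr// => /le_lt_trans/(_ h).
  by rewrite mulrC ltr_pM2r// ltr_nat ltnNge leqnSn.
move: W1; rewrite /W /ratio wallis00 wallis0 ?gt_eqF//; last by lra.
rewrite /c /D !addr0 add0r Beta1r// invr1 divr1 mulr0 !add0r divr1.
have -> : 2 * l * (pi / 2) = pi * l by field.
have pi0 := pi_gt0 R.
have s0 : 0 < sin (pi * l).
  by apply: sin_gt0_pi; rewrite mulr_gt0//= gtr_pMr.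
move: (@pi R) pi0 s0 => p p0 s0 E.
have -> : Beta l (1 - l) = p / sin (p * l) *
    (sin (p * l) / (2 * l) / (p / 2) * Beta l (1 - l) * l).
  by field; rewrite !gt_eqF//.
by rewrite E mulr1.
Qed.

End Reflection.

(** * Integrals against a density with a given mean *)

Section pointwise.
Local Open Scope ereal_scope.

(** Holds for arbitrary functions: both parts of the integral are suprema over
    the simple functions lying below the positive or negative part. *)
Lemma le_integral_pointwise d (T : measurableType d) (R : realType)
    (mu : {measure set T -> \bar R}) (D : set T) (F G : T -> \bar R) :
  (forall t, D t -> F t <= G t) ->
  \int[mu]_(t in D) F t <= \int[mu]_(t in D) G t.
Proof.
move=> FG; have FGD t : (F \_ D)%classic t <= (G \_ D)%classic t.
  by rewrite !patchE; case: ifPn => // /set_mem; exact: FG.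
rewrite /integral; apply: leeB.
- apply: le_ereal_sup => _ [h /= hF <-]; exists h => //= t.
  by apply: (le_trans (hF t)); rewrite !funeposE ge_max !le_max FGD lexx orbT.
- apply: le_ereal_sup => _ [h /= hG <-]; exists h => //= t.
  apply: (le_trans (hG t)).
  by rewrite !funenegE ge_max !le_max leeN2 FGD lexx orbT.
Qed.

End pointwise.

Section barycenter.
Local Open Scope ereal_scope.
Context {R : realType}.
Implicit Types (w : R -> R) (F : R -> \bar R).

(** [w] is the density of a probability measure on [[0, 1]] with mean [m],
    expressed by its effect on affine functions (take a = b = 1 for the mass,
    a = 0 and b = 1 for the mean). *)
Definition barycenter w (m : R) : Prop :=
  (forall t, 0 <= w t)%R /\
  forall a b : R, integral01 w (fun t => ((1 - t) * a + t * b)%:E) =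
                  ((1 - m) * a + m * b)%:E.

Lemma le_integral01 w F G : (forall t, 0 <= w t)%R ->
  (forall t, (0 <= t <= 1)%R -> F t <= G t) ->
  integral01 w F <= integral01 w G.
Proof.
move=> w0 FG; apply: le_integral_pointwise => t /=; rewrite in_itv/= => t01.
by apply: lee_wpmul2l; [rewrite lee_fin|exact: FG].
Qed.

End barycenter.

(** * The two probability densities *)

Section Densities.
Context {R : realType}.
Local Notation mu := (@lebesgue_measure R).
Local Notation I01 := (`]0, 1[%classic : set R).
Implicit Types (w : R -> R) (l m t : R).

Lemma barycenterP w m : (forall t, 0 <= w t)%R ->
  mu.-integrable I01 (EFin \o w) ->
  mu.-integrable I01 (EFin \o (fun t => t * w t)%R) ->
  (\int[mu]_(t in I01) w t = 1)%R -> (\int[mu]_(t in I01) (t * w t) = m)%R ->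
  barycenter w m.
Proof.
move=> w0 iw itw w1 tw; split=> // a b.
have ia : mu.-integrable I01 (EFin \o (fun t => a * w t)%R).
  exact: (integrableZl _ a iw).
have ib : mu.-integrable I01 (EFin \o (fun t => (b - a) * (t * w t))%R).
  exact: (integrableZl _ (b - a) itw).
have E t : ((w t)%:E * ((1 - t) * a + t * b)%:E)%E =
    (a * w t + (b - a) * (t * w t))%:E by rewrite -EFinM; congr _%:E; ring.
have iE : mu.-integrable I01
    (EFin \o (fun t => a * w t + (b - a) * (t * w t))%R).
  exact: (integrableD _ ia ib).
rewrite /integral01; under eq_integral do rewrite E.
rewrite integral_itv_bndoo; last exact: (measurable_int _ iE).
rewrite -[LHS]fineK; last exact: (integrable_fin_num _ iE).
rewrite -/(Rintegral _ _ _) RintegralD// !RintegralZl// w1 tw.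
by congr _%:E; ring.
Qed.

Lemma Rintegral_beta_ker (a b c d k h : R) :
  (0 < a)%R -> (0 < b)%R -> (0 < c)%R -> (0 < d)%R ->
  mu.-integrable I01 (EFin \o (fun t => k * beta_ker a b t + h * beta_ker c d t)%R) /\
  (\int[mu]_(t in I01) (k * beta_ker a b t + h * beta_ker c d t) =
    k * Beta a b + h * Beta c d)%R.
Proof.
move=> a0 b0 c0 d0; have iab := integrable_beta_ker a0 b0.
have icd := integrable_beta_ker c0 d0.
have i1 : mu.-integrable I01 (EFin \o (fun t => k * beta_ker a b t)%R).
  exact: (integrableZl _ k iab).
have i2 : mu.-integrable I01 (EFin \o (fun t => h * beta_ker c d t)%R).
  exact: (integrableZl _ h icd).
split; first exact: (integrableD _ i1 i2).
by rewrite RintegralD// !RintegralZl.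
Qed.

(** Both densities are combinations of at most two Beta kernels, and
    multiplication by t shifts the first parameter of each. *)
Lemma barycenter_beta_ker w (a b c d k h m : R) :
  (0 < a)%R -> (0 < b)%R -> (0 < c)%R -> (0 < d)%R ->
  (forall t, 0 <= w t)%R ->
  (forall t, 0 < t < 1 -> w t = k * beta_ker a b t + h * beta_ker c d t)%R ->
  (k * Beta a b + h * Beta c d = 1)%R ->
  (k * Beta (a + 1) b + h * Beta (c + 1) d = m)%R ->
  barycenter w m.
Proof.
move=> a0 b0 c0 d0 w0 wE E1 Em.
have a1 : (0 < a + 1)%R by lra. have c1 : (0 < c + 1)%R by lra.
have [i1 I1] := @Rintegral_beta_ker a b c d k h a0 b0 c0 d0.
have [i2 I2] := @Rintegral_beta_ker (a + 1) b (c + 1) d k h a1 b0 c1 d0.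
have e1 : {in I01, w =1 (fun t => k * beta_ker a b t + h * beta_ker c d t)%R}.
  by move=> t; rewrite inE/= in_itv/= => /wE.
have e2 : {in I01, (fun t => t * w t)%R =1
    (fun t => k * beta_ker (a + 1) b t + h * beta_ker (c + 1) d t)%R}.
  move=> t; rewrite inE/= in_itv/= => t01.
  by rewrite wE// !beta_kerDl//; ring.
apply: barycenterP => //.
- apply: eq_integrable i1 => // t tI /=; by rewrite e1.
- apply: eq_integrable i2 => // t tI /=; by rewrite -e2.
- by rewrite -[RHS]E1 -I1; apply: eq_Rintegral => t /e1.
- by rewrite -[RHS]Em -I2; apply: eq_Rintegral => t /e2.
Qed.

(** The mass is the reflection formula; the mean is
    B(l+1, 1-l) / B(l, 1-l) = l. *)
Lemma barycenter_mu l : (0 < l < 1)%R -> barycenter (mu_density l) l.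
Proof.
move=> /[dup] l01 /andP[l0 l1]; have pi0 := pi_gt0 R.
have l1' : (0 < 1 - l)%R by rewrite subr_gt0.
have s0 : (0 < sin (pi * l))%R.
  by apply: sin_gt0_pi; rewrite mulr_gt0//= gtr_pMr.
pose C : R := (sin (pi * l) / pi)%R.
have C1 : (C * Beta l (1 - l) = 1)%R.
  rewrite Beta_reflection// /C; move: (@pi R) pi0 s0 => p p0 s0.
  by field; rewrite !gt_eqF//.
apply: (@barycenter_beta_ker _ l (1 - l) l (1 - l) C 0) => //.
- move=> t; rewrite /mu_density mulr_ge0// ?divr_ge0 ?powR_ge0//; exact: ltW.
- move=> t _; rewrite mul0r addr0 /mu_density /beta_ker /C.
  by rewrite (_ : 1 - l - 1 = - l)%R ?powRN//; ring.
- by rewrite mul0r addr0.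
- by rewrite mul0r addr0 BetaDl// subrKC divr1 mulrCA C1 mulr1.
Qed.

(** The two terms have masses l and 1 - l, and first moments l^2 and
    l (1 - l). *)
Lemma barycenter_nu l : (0 < l < 1)%R -> barycenter (nu_density l) l.
Proof.
move=> /andP[l0 l1]; have l1' : (0 < 1 - l)%R by rewrite subr_gt0.
have a0 : (0 < (1 - l) / l)%R by rewrite divr_gt0.
have b0 : (0 < l / (1 - l))%R by rewrite divr_gt0.
apply: (@barycenter_beta_ker _ 1 ((1 - l) / l) (l / (1 - l)) 1 (1 - l) l) => //.
- by move=> t; rewrite addr_ge0// mulr_ge0 ?powR_ge0// ltW.
- move=> t _; rewrite /nu_density /beta_ker subrr !powRr0 mul1r mulr1.
  congr (_ * _ `^ _ + _ * _ `^ _)%R.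
  + by field; rewrite gt_eqF.
  + by field; rewrite gt_eqF.
- rewrite Beta1l// Beta1r//; field; by rewrite !gt_eqF.
- rewrite !BetaDl// Beta1l// Beta1r//; field.
  by rewrite !gt_eqF//; lra.
Qed.

End Densities.

Local Open Scope ereal_scope.

(** * Fenchel conjugation and the functional means *)

Lemma Re_conjC (R : realType) (z : R[i]) :
  complex.Re (Num.conj z) = complex.Re z.
Proof. by case: z. Qed.

Section means.
Context {R : realType} {H : completeNormedModType R[i]}.
Variable dot : {dot H for (@Num.conj R[i])}.
Implicit Types f g : H -> \bar R.

Lemma fenchel_ge f x y : (complex.Re (dot y x))%:E - f x <= fenchel dot f y.
Proof. by apply: ereal_sup_ubound; exists x. Qed.

Lemma fenchel_le f y c :
  (forall x, (complex.Re (dot y x))%:E - f x <= c) -> fenchel dot f y <= c.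
Proof. by move=> fc; apply: ge_ereal_sup => _ [x _ <-]. Qed.

Lemma fenchel_antimono f g y :
  (forall x, f x <= g x) -> fenchel dot g y <= fenchel dot f y.
Proof.
move=> fg; apply: fenchel_le => x; apply: (le_trans _ (fenchel_ge f x y)).
exact: leeB.
Qed.

Lemma fenchel_neqNy f y : (exists x, f x != +oo) -> fenchel dot f y != -oo.
Proof.
move=> [x fx]; rewrite -ltNye; apply: (lt_le_trans _ (fenchel_ge f x y)).
by case: (f x) fx => [a _|//|_]; rewrite ?addey// -EFinB ltNyr.
Qed.

Lemma Re_dotC x y : complex.Re (dot x y) = complex.Re (dot y x).
Proof. by rewrite hermC expr0 mul1r Re_conjC. Qed.

Lemma fenchel_fenchel_le f x : fenchel dot (fenchel dot f) x <= f x.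
Proof.
apply: fenchel_le => y; have := fenchel_ge f x y; rewrite Re_dotC.
case: (f x) => [a| |]; last by rewrite /= leye_eq => /eqP ->.
- case: (fenchel dot f y) => [b| |] //=; last by rewrite leNye.
  by rewrite -!EFinB !lee_fin; lra.
- by rewrite leey.
Qed.

Lemma arithmetic_fin f g x (a b t : R) : f x = a%:E -> g x = b%:E ->
  arithmetic_fmean t f g x = ((1 - t) * a + t * b)%:E.
Proof.
move=> fx gx; rewrite /arithmetic_fmean.
have [->|_] := eqVneq t 0%R; first by rewrite fx; congr _%:E; ring.
have [->|_] := eqVneq t 1%R; first by rewrite gx; congr _%:E; ring.
by rewrite fx gx.
Qed.

Lemma arithmetic01 f g x (t : R) : (0 < t < 1)%R ->
  arithmetic_fmean t f g x = (1 - t)%:E * f x + t%:E * g x.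
Proof.
by case/andP => t0 t1; rewrite /arithmetic_fmean (gt_eqF t0) (lt_eqF t1).
Qed.

(** The case distinction behind all comparisons: when the arithmetic mean is
    infinite at x every upper bound by it is trivial, and otherwise it is affine in the
    weight. *)
Lemma arithmetic_finVy f g x (t : R) : f x != -oo -> g x != -oo ->
  (0 < t < 1)%R ->
  (exists a b, f x = a%:E /\ g x = b%:E) \/ arithmetic_fmean t f g x = +oo.
Proof.
move=> fx gx t01; rewrite arithmetic01//; case/andP: t01 => t0 t1.
have t1' : (0 < 1 - t)%R by lra.
case: (f x) fx => [a| |] // _; case: (g x) gx => [b| |] // _.
- by left; exists a, b.
- by right; rewrite gt0_muley ?lte_fin.
- by right; rewrite gt0_muley ?lte_fin.
- by right; rewrite !gt0_muley ?lte_fin.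
Qed.

(** The integrand is bounded above by an affine function of t unless the
    right-hand side is infinite. *)
Lemma integral01_le_arithmetic w (m : R) F f g x :
  barycenter w m -> (0 < m < 1)%R -> f x != -oo -> g x != -oo ->
  (forall t, (0 <= t <= 1)%R -> F t <= arithmetic_fmean t f g x) ->
  integral01 w F <= arithmetic_fmean m f g x.
Proof.
move=> [w0 wm] m01 fx gx Fle.
have [[a [b [fa gb]]]|->] := arithmetic_finVy fx gx m01; last exact: leey.
rewrite (arithmetic_fin _ fa gb) -wm; apply: le_integral01 => // t t01.
by rewrite -(arithmetic_fin _ fa gb); exact: Fle.
Qed.

(** Jensen's inequality for suprema of affine functions: each term of the
    supremum on the left is the integral of an affine lower bound of F. *)
Lemma fenchel_arithmetic_le_integral01 w (m : R) F f g y :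
  barycenter w m -> (0 < m < 1)%R ->
  (forall x, f x != -oo) -> (forall x, g x != -oo) ->
  (forall t, (0 <= t <= 1)%R -> fenchel dot (arithmetic_fmean t f g) y <= F t) ->
  fenchel dot (arithmetic_fmean m f g) y <= integral01 w F.
Proof.
move=> [w0 wm] m01 f_ g_ Fge; apply: fenchel_le => x.
have [[a [b [fa gb]]]|->] := arithmetic_finVy (f_ x) (g_ x) m01; last first.
  by rewrite addeC leNye.
rewrite (arithmetic_fin _ fa gb); set r := complex.Re _.
have -> : r%:E - ((1 - m) * a + m * b)%:E =
    integral01 w (fun t => ((1 - t) * (r - a) + t * (r - b))%:E).
  by rewrite wm -EFinB; congr _%:E; ring.
apply: le_integral01 => // t t01; apply: (le_trans _ (Fge t t01)).
apply: (le_trans _ (fenchel_ge _ x y)).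
by rewrite (arithmetic_fin _ fa gb) -EFinB lee_fin -/r; lra.
Qed.

(** The supremum of a sum is at most the sum of the suprema. Equivalently,
    t |-> (conjugate of the arithmetic mean with weight t) lies below its
    chord. *)
Lemma fenchel_arithmetic_le f g y (t : R) : (0 <= t <= 1)%R ->
  (forall x, f x != -oo) -> (forall x, g x != -oo) ->
  fenchel dot f y != -oo -> fenchel dot g y != -oo ->
  fenchel dot (arithmetic_fmean t f g) y <=
  arithmetic_fmean t (fenchel dot f) (fenchel dot g) y.
Proof.
move=> t01 f_ g_ fy gy.
have [->|t0] := eqVneq t 0%R; first by rewrite /arithmetic_fmean eqxx.
have [->|t1] := eqVneq t 1%R.
  by rewrite /arithmetic_fmean eqxx (negbTE (oner_neq0 _)).
have {}t01 : (0 < t < 1)%R.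
  by case/andP : t01 => ? ?; rewrite lt_neqAle eq_sym t0 lt_neqAle t1; apply/andP.
have [[a [b [fa gb]]]|->] := arithmetic_finVy fy gy t01; last exact: leey.
rewrite (arithmetic_fin _ fa gb); apply: fenchel_le => x.
have [[c [d [fc gd]]]|->] := arithmetic_finVy (f_ x) (g_ x) t01; last first.
  by rewrite addeC leNye.
have := fenchel_ge f x y; have := fenchel_ge g x y.
rewrite (arithmetic_fin _ fc gd) fa gb fc gd -!EFinB !lee_fin.
by case/andP : t01; nra.
Qed.

Lemma harmonic01 f g x (t : R) : (0 < t < 1)%R ->
  harmonic_fmean dot t f g x =
  fenchel dot (arithmetic_fmean t (fenchel dot f) (fenchel dot g)) x.
Proof.
move=> /[dup] t01 /andP[t0 t1].
rewrite /harmonic_fmean (gt_eqF t0) (lt_eqF t1).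
by congr (fenchel dot _ x); apply/funext => y; rewrite arithmetic01.
Qed.

Lemma itvcc01_cases (t : R) : (0 <= t <= 1)%R ->
  [\/ t = 0%R, t = 1%R | (0 < t < 1)%R].
Proof.
move=> /andP[]; rewrite le_eqVlt => /predU1P[<-|t0]; first by constructor 1.
rewrite le_eqVlt => /predU1P[->|t1]; first by constructor 2.
by constructor 3; apply/andP.
Qed.

(** An equality inside the interval; at the two end points, where the harmonic
    mean is f or g by convention, it is the inequality between a functional
    and its biconjugate. *)
Lemma fenchel_arithmetic_le_harmonic f g x (t : R) : (0 <= t <= 1)%R ->
  fenchel dot (arithmetic_fmean t (fenchel dot f) (fenchel dot g)) x <=
  harmonic_fmean dot t f g x.
Proof.
case/itvcc01_cases => [->|->|t01]; last by rewrite harmonic01.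
- by rewrite /arithmetic_fmean /harmonic_fmean eqxx fenchel_fenchel_le.
- rewrite /arithmetic_fmean /harmonic_fmean (negbTE (oner_neq0 _)) eqxx.
  exact: fenchel_fenchel_le.
Qed.

Section proper.
Variables f g : H -> \bar R.
Hypotheses (fNy : forall x, f x != -oo) (gNy : forall x, g x != -oo).
Hypotheses (fy : exists x, f x != +oo) (gy : exists x, g x != +oo).

(** Conjugating [fenchel_arithmetic_le] puts the harmonic mean below the
    biconjugate of the arithmetic mean. *)
Lemma harmonic_le_arithmetic x (t : R) : (0 <= t <= 1)%R ->
  harmonic_fmean dot t f g x <= arithmetic_fmean t f g x.
Proof.
move=> /[dup] t01' /itvcc01_cases[->|->|t01].
- by rewrite /arithmetic_fmean /harmonic_fmean eqxx.
- by rewrite /arithmetic_fmean /harmonic_fmean (negbTE (oner_neq0 _)) eqxx.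
- rewrite harmonic01//; apply: (le_trans _ (fenchel_fenchel_le _ x)).
  apply: fenchel_antimono => y.
  by apply: fenchel_arithmetic_le => //; exact: fenchel_neqNy.
Qed.

Lemma geometric_le_arithmetic x (t : R) : (0 <= t <= 1)%R ->
  geometric_fmean dot t f g x <= arithmetic_fmean t f g x.
Proof.
move=> /itvcc01_cases[->|->|/[dup] t01 /andP[t0 t1]].
- by rewrite /arithmetic_fmean /geometric_fmean eqxx.
- by rewrite /arithmetic_fmean /geometric_fmean (negbTE (oner_neq0 _)) eqxx.
- rewrite /geometric_fmean (gt_eqF t0) (lt_eqF t1) /=.
  apply: (integral01_le_arithmetic (barycenter_mu t01)) => // s s01.
  exact: harmonic_le_arithmetic.
Qed.

Lemma fenchel_arithmetic_le_geometric x (t : R) : (0 <= t <= 1)%R ->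
  fenchel dot (arithmetic_fmean t (fenchel dot f) (fenchel dot g)) x <=
  geometric_fmean dot t f g x.
Proof.
move=> /[dup] t01' /itvcc01_cases[t0|t1|/[dup] t01 /andP[t0 t1]].
- have := fenchel_arithmetic_le_harmonic f g x t01'.
  by rewrite t0 /harmonic_fmean /geometric_fmean eqxx.
- have := fenchel_arithmetic_le_harmonic f g x t01'.
  by rewrite t1 /harmonic_fmean /geometric_fmean eqxx (negbTE (oner_neq0 _)).
- rewrite /geometric_fmean (gt_eqF t0) (lt_eqF t1) /=.
  apply: (fenchel_arithmetic_le_integral01 (barycenter_mu t01)) => //.
  + by move=> y; exact: fenchel_neqNy.
  + by move=> y; exact: fenchel_neqNy.
  + by move=> s s01; exact: fenchel_arithmetic_le_harmonic.
Qed.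

Lemma harmonic_le_dual_log x (l : R) : (0 < l < 1)%R ->
  harmonic_fmean dot l f g x <= dual_log_fmean dot l f g x.
Proof.
move=> l01; rewrite harmonic01//; apply: fenchel_antimono => y.
apply: (integral01_le_arithmetic (barycenter_nu l01)) => //.
- exact: fenchel_neqNy.
- exact: fenchel_neqNy.
- by move=> t t01; apply: fenchel_arithmetic_le => //; exact: fenchel_neqNy.
Qed.

Lemma log_le_arithmetic x (l : R) : (0 < l < 1)%R ->
  log_fmean dot l f g x <= arithmetic_fmean l f g x.
Proof.
move=> l01; apply: (integral01_le_arithmetic (barycenter_nu l01)) => // t t01.
exact: geometric_le_arithmetic.
Qed.

Lemma fenchel_dual_log_le_log x (l : R) : (0 < l < 1)%R ->
  fenchel dot (dual_log_fmean dot l (fenchel dot f) (fenchel dot g)) x <=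
  log_fmean dot l f g x.
Proof.
move=> l01; apply: (le_trans (fenchel_fenchel_le _ x) _).
apply: le_integral01 => [|t t01]; first by case: (barycenter_nu l01).
exact: fenchel_arithmetic_le_geometric.
Qed.

End proper.

(** The integral under the conjugation is at least the conjugate of the
    arithmetic mean, so conjugating leaves a biconjugate as upper bound. *)
Lemma dual_log_le_arithmetic f g x (l : R) : (0 < l < 1)%R ->
  (forall x, f x != -oo) -> (forall x, g x != -oo) ->
  dual_log_fmean dot l f g x <= arithmetic_fmean l f g x.
Proof.
move=> l01 f_ g_; apply: (le_trans _ (fenchel_fenchel_le _ x)).
apply: fenchel_antimono => y.
exact: (fenchel_arithmetic_le_integral01 (barycenter_nu l01)).
Qed.

End means.

(** * The two chains of inequalities *)

Theorem proposition4p1 (R : realType) (H : completeNormedModType R[i])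
    (dot : {dot H for (@Num.conj R[i])}) (hdot : induces_norm dot)
    (f g : H -> \bar R) (hf : Gamma0 f) (hg : Gamma0 g)
    (l : R) (hl : (0 < l < 1)%R) :
  (forall x : H,
     harmonic_fmean dot l f g x <= dual_log_fmean dot l f g x /\
     dual_log_fmean dot l f g x <= arithmetic_fmean l f g x) /\
  (forall x : H,
     [/\ harmonic_fmean dot l f g x <=
           fenchel dot
             (dual_log_fmean dot l (fenchel dot f) (fenchel dot g)) x,
         fenchel dot
           (dual_log_fmean dot l (fenchel dot f) (fenchel dot g)) x <=
           log_fmean dot l f g x &
         log_fmean dot l f g x <= arithmetic_fmean l f g x]).
Proof.
case: hf hg => [fNy fy _ _] [gNy gy _ _].
have f'Ny y : fenchel dot f y != -oo by exact: fenchel_neqNy.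
have g'Ny y : fenchel dot g y != -oo by exact: fenchel_neqNy.
split=> x; split.
- exact: harmonic_le_dual_log.
- exact: dual_log_le_arithmetic.
- rewrite harmonic01//; apply: fenchel_antimono => y.
  exact: dual_log_le_arithmetic.
- exact: fenchel_dual_log_le_log.
- exact: log_le_arithmetic.
Qed.
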